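(* Let $Q$ be a quiver without oriented cycles, let $\alpha,\beta$ be dimension vectors of $Q$, and fix $V\in\mathrm{Rep}(Q,\alpha)$. Let $U_V$ be a dense open subset of $\mathrm{Rep}(Q,\beta)$ with the following properties: (i) $\dim\mathrm{Hom}_Q(V,W)$ does not depend on $W\in U_V$; (ii) there is a dimension vector $\gamma$ such that for every $W\in U_V$, a dense open subset of $\mathrm{Hom}_Q(V,W)$ consists of morphisms $\phi$ of rank $\gamma$. Fix some $W\in U_V$. If $\phi\in\mathrm{Hom}_Q(V,W)$ has rank $\gamma$ and $S=\ker\phi$ (a subrepresentation of $V$ of dimension vector $\alpha-\gamma$), then the canonical surjection $\mathrm{Ext}_Q(V,W)\twoheadrightarrow\mathrm{Ext}_Q(S,W)$ is an isomorphism.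
   Context: A quiver $Q$ consists of a finite set $Q_0$ of vertices, a finite set $Q_1$ of arrows, and maps $h,t:Q_1\to Q_0$ (head and tail). A dimension vector is a function $Q_0\to\mathbb{Z}_{\ge0}$. $\mathrm{Rep}(Q,\alpha)=\prod_{a\in Q_1}\mathrm{Hom}(\mathbb{C}^{\alpha(ta)},\mathbb{C}^{\alpha(ha)})$ is an affine space whose points are the representations of $Q$ of dimension vector $\alpha$. For representations $V,W$ of dimension vectors $\alpha,\beta$, a morphism $\phi:V\to W$ is a collection of linear maps $\phi(x):\mathbb{C}^{\alpha(x)}\to\mathbb{C}^{\beta(x)}$, $x\in Q_0$, with $\phi(ha)\circ V(a)=W(a)\circ\phi(ta)$ for all $a\in Q_1$. The space of morphisms is $\mathrm{Hom}_Q(V,W)=\ker d^V_W$ and $\mathrm{Ext}_Q(V,W)=\mathrm{coker}\, d^V_W$ (which is $\mathrm{Ext}^1$ in the abelian category of representations, where all higher $\mathrm{Ext}$ vanish), where $$d^V_W:\bigoplus_{x\in Q_0}\mathrm{Hom}(\mathbb{C}^{\alpha(x)},\mathbb{C}^{\beta(x)})\to\bigoplus_{a\in Q_1}\mathrm{Hom}(\mathbb{C}^{\alpha(ta)},\mathbb{C}^{\beta(ha)}),\quad \{\phi(x)\}\mapsto\{W(a)\circ\phi(ta)-\phi(ha)\circ V(a)\}.$$ A morphism $\phi$ has rank $\gamma$ if $\mathrm{rank}\,\phi(x)=\gamma(x)$ for all $x\in Q_0$. The canonical surjection $\mathrm{Ext}_Q(V,W)\to\mathrm{Ext}_Q(S,W)$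 is the one induced by the inclusion $S\hookrightarrow V$. *)

(* Defs.v *)
From HB Require Import structures.
From mathcomp Require Import all_boot all_order all_algebra.
From mathcomp Require Import generic_quotient ring_quotient.
From mathcomp Require Import classical_sets reals.
From mathcomp Require Import mpoly complex.

Set Implicit Arguments.
Unset Strict Implicit.
Unset Printing Implicit Defensive.

Import GRing.Theory VectorInternalTheory.

Local Open Scope ring_scope.
Local Open Scope quotient_scope.

(* Finite products of vector spaces: MathComp only has the non-dependent
   [{ffun I -> vT}] as a [vectType]. *)
Section ProdV.
Variables (K : fieldType) (I : finType) (E : I -> vectType K).

Record prodv := ProdV { prodv_val : {dffun forall i : I, E i} }.
HB.instance Definition _ := [isNew for prodv_val].
HB.instance Definition _ := [Choice of prodv by <:].

Definition prodv_fun (f : prodv) (i : I) : E i := prodv_val f i.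
Coercion prodv_fun : prodv >-> Funclass.

Definition mkprodv (f : forall i, E i) : prodv := ProdV [ffun i => f i].

Lemma mkprodvE f i : mkprodv f i = f i.
Proof. exact: ffunE. Qed.

Lemma prodvP (f g : prodv) : (forall i, f i = g i) <-> f = g.
Proof. by split=> [fg|-> //]; apply: val_inj; apply/ffunP. Qed.

Definition prodv_add (f g : prodv) := mkprodv (fun i => f i + g i).
Definition prodv_opp (f : prodv) := mkprodv (fun i => - f i).
Definition prodv_zero := mkprodv (fun i => 0).
Definition prodv_scale (c : K) (f : prodv) := mkprodv (fun i => c *: f i).

Fact prodv_addA : associative prodv_add.
Proof. by move=> f g h; apply/prodvP=> i; rewrite !mkprodvE addrA. Qed.
Fact prodv_addC : commutative prodv_add.
Proof. by move=> f g; apply/prodvP=> i; rewrite !mkprodvE addrC. Qed.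
Fact prodv_add0 : left_id prodv_zero prodv_add.
Proof. by move=> f; apply/prodvP=> i; rewrite !mkprodvE add0r. Qed.
Fact prodv_addN : left_inverse prodv_zero prodv_opp prodv_add.
Proof. by move=> f; apply/prodvP=> i; rewrite !mkprodvE addNr. Qed.
HB.instance Definition _ :=
  GRing.isZmodule.Build prodv prodv_addA prodv_addC prodv_add0 prodv_addN.

Fact prodv_scaleA a b f :
  prodv_scale a (prodv_scale b f) = prodv_scale (a * b) f.
Proof. by apply/prodvP=> i; rewrite !mkprodvE scalerA. Qed.
Fact prodv_scale1 : left_id 1 prodv_scale.
Proof. by move=> f; apply/prodvP=> i; rewrite !mkprodvE scale1r. Qed.
Fact prodv_scaleDr : right_distributive prodv_scale +%R.
Proof. by move=> a f g; apply/prodvP=> i; rewrite !mkprodvE scalerDr. Qed.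
Fact prodv_scaleDl f : {morph prodv_scale^~ f : a b / a + b}.
Proof. by move=> a b; apply/prodvP=> i; rewrite !mkprodvE scalerDl. Qed.
HB.instance Definition _ := GRing.Zmodule_isLmodule.Build K prodv
  prodv_scaleA prodv_scale1 prodv_scaleDr prodv_scaleDl.

Lemma prodvD (f g : prodv) i : (f + g) i = f i + g i.
Proof. exact: mkprodvE. Qed.
Lemma prodvZ c (f : prodv) i : (c *: f) i = c *: f i.
Proof. exact: mkprodvE. Qed.

Fact prodv_vect_iso : Vector.axiom #|{: {i : I & 'I_(dim (E i))}}| prodv.
Proof.
exists (fun f : prodv => \row_k
  v2r (f (tag (enum_val k))) 0 (tagged (enum_val k))).
  by move=> c f g; apply/rowP=> k; rewrite !mxE prodvD prodvZ linearP !mxE.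
pose N := #|{: {i : I & 'I_(dim (E i))}}|.
exists (fun r : 'rV[K]_N => mkprodv (fun i =>
  r2v (\row_j r 0 (enum_rank (Tagged (fun i => 'I_(dim (E i))) j))))) => [f|r].
  apply/prodvP=> i; rewrite mkprodvE -[RHS]v2rK; congr r2v.
  by apply/rowP=> j; rewrite !mxE enum_rankK.
apply/rowP=> k; rewrite mxE mkprodvE r2vK mxE.
by congr (r 0 _); rewrite -[RHS]enum_valK; congr enum_rank; case: (enum_val k).
Qed.
HB.instance Definition _ := Lmodule_hasFinDim.Build K prodv prodv_vect_iso.

End ProdV.

(* The Zariski topology on the affine space underlying [E], in the coordinates
   of a fixed basis; it does not depend on that basis. *)
Section Zariski.
Variables (K : fieldType) (E : vectType K).

Definition zariski_closed (A : set E) : Prop :=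
  exists F : set {mpoly K[\dim {:E}]},
    forall v, A v <->
      forall p, F p -> p.@[fun i => coord (vbasis {:E}) i v] = 0.

Definition zariski_open (A : set E) : Prop := zariski_closed (~` A)%classic.

Definition zariski_dense (A : set E) : Prop :=
  forall B : set E, zariski_open B -> (B !=set0 -> (B `&` A) !=set0)%classic.

End Zariski.

Section Coker.
Variables (K : fieldType) (aT rT : vectType K) (f : 'Hom(aT, rT)).

Definition coker : Type := Quotient.quot (pred_of_vspace (limg f)).
HB.instance Definition _ := GRing.Zmodule.on coker.

Definition coker_pi (y : rT) : coker :=
  \pi_(Quotient.quot (pred_of_vspace (limg f))) y.
Definition coker_repr (e : coker) : rT :=
  repr (e : Quotient.quot (pred_of_vspace (limg f))).

Lemma coker_piP (x y : rT) : coker_pi x = coker_pi y <-> x - y \in limg f.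
Proof.
by rewrite (Quotient.idealrBE (pred_of_vspace (limg f))); split=> /eqP.
Qed.

Lemma coker_piK (e : coker) : coker_pi (coker_repr e) = e.
Proof. exact: reprK. Qed.

Lemma coker_piD x y : coker_pi (x + y) = coker_pi x + coker_pi y.
Proof. exact: (Quotient.pi_add (pred_of_vspace (limg f))). Qed.

Definition coker_scale (c : K) (e : coker) : coker :=
  coker_pi (c *: coker_repr e).

Lemma coker_scale_pi c x : coker_scale c (coker_pi x) = coker_pi (c *: x).
Proof.
by apply/coker_piP; rewrite -scalerBr memvZ //; apply/coker_piP/coker_piK.
Qed.

Fact coker_scaleA a b e :
  coker_scale a (coker_scale b e) = coker_scale (a * b) e.
Proof. by rewrite -[e]coker_piK !coker_scale_pi scalerA. Qed.
Fact coker_scale1 : left_id 1 coker_scale.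
Proof. by move=> e; rewrite -[e]coker_piK coker_scale_pi scale1r. Qed.
Fact coker_scaleDr : right_distributive coker_scale +%R.
Proof.
move=> a d e; rewrite -[d]coker_piK -[e]coker_piK -coker_piD !coker_scale_pi.
by rewrite scalerDr coker_piD.
Qed.
Fact coker_scaleDl e : {morph coker_scale^~ e : a b / a + b}.
Proof.
by move=> a b; rewrite -[e]coker_piK !coker_scale_pi scalerDl coker_piD.
Qed.
HB.instance Definition _ := GRing.Zmodule_isLmodule.Build K coker
  coker_scaleA coker_scale1 coker_scaleDr coker_scaleDl.

Fact coker_pi_linear : linear coker_pi.
Proof. by move=> c x y; rewrite coker_piD -coker_scale_pi. Qed.
HB.instance Definition _ := GRing.isLinear.Build K rT coker _ coker_pi
  coker_pi_linear.

End Coker.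

Record quiver := Quiver {
  vertex : finType;
  arrow : finType;
  tail : arrow -> vertex;
  head : arrow -> vertex
}.

Definition no_oriented_cycle (Q : quiver) : Prop :=
  forall s : seq (arrow Q), cycle [rel a b | head a == tail b] s -> s = [::].

Section Representations.
Variables (K : fieldType) (Q : quiver).
Implicit Types E F G : vertex Q -> vectType K.

(* Representations on an arbitrary family of finite dimensional spaces, so that
   a kernel is again a representation without a choice of bases. *)
Definition repn E : Type := prodv (fun a => 'Hom(E (tail a), E (head a))).

Definition std_space (alpha : vertex Q -> nat) : vertex Q -> vectType K :=
  fun x => 'cV[K]_(alpha x).

Definition Rep (alpha : vertex Q -> nat) : Type := repn (std_space alpha).

Definition hom0 E F : Type := prodv (fun x => 'Hom(E x, F x)).
Definition hom1 E F : Type := prodv (fun a => 'Hom(E (tail a), F (head a))).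

Section Differential.
Variables (E F : vertex Q -> vectType K) (V : repn E) (W : repn F).

Definition dfun (phi : hom0 E F) : hom1 E F :=
  mkprodv (fun a => ((W a \o phi (tail a)) - (phi (head a) \o V a))%VF).

Fact dfun_linear : linear dfun.
Proof.
move=> c f g; apply/prodvP=> a; rewrite !mkprodvE.
apply/lfunP=> u; rewrite !(add_lfunE, opp_lfunE, scale_lfunE, comp_lfunE).
by rewrite linearP scalerBr opprD addrACA.
Qed.
HB.instance Definition _ := GRing.isLinear.Build K _ _ _ dfun dfun_linear.

Definition d_map : 'Hom(hom0 E F, hom1 E F) := linfun dfun.

Definition HomQ : {vspace hom0 E F} := lker d_map.
Definition homQ : vectType K := subvs_of HomQ.
Definition ExtQ : lmodType K := coker d_map.

Definition hom_at (phi : homQ) (x : vertex Q) : 'Hom(E x, F x) := vsval phi x.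

Lemma HomQP (phi : hom0 E F) : phi \in HomQ <->
  forall a, (W a \o phi (tail a))%VF = (phi (head a) \o V a)%VF.
Proof.
rewrite memv_ker lfunE /=; split=> [/eqP/prodvP d0 a|d0].
  by apply/eqP; rewrite -subr_eq0; have:= d0 a; rewrite !mkprodvE => ->.
by apply/eqP/prodvP=> a; rewrite !mkprodvE d0 subrr.
Qed.

Definition has_rank (phi : homQ) (gamma : vertex Q -> nat) : Prop :=
  forall x, \dim (limg (hom_at phi x)) = gamma x.

End Differential.

Section ExtMap.
Variables (E F G : vertex Q -> vectType K).
Variables (S : repn E) (V : repn F) (W : repn G) (iota : homQ S V).

Definition precomp (X : hom1 F G) : hom1 E G :=
  mkprodv (fun a => (X a \o hom_at iota (tail a))%VF).

Fact precomp_linear : linear precomp.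
Proof.
move=> c f g; apply/prodvP=> a; rewrite !mkprodvE.
by apply/lfunP=> u; rewrite !(add_lfunE, scale_lfunE, comp_lfunE).
Qed.
HB.instance Definition _ := GRing.isLinear.Build K _ _ _ precomp precomp_linear.

Lemma precomp_limg X :
  X \in limg (d_map V W) -> precomp X \in limg (d_map S W).
Proof.
case/memv_imgP=> phi _ ->; have /HomQP iotaP := valP iota.
apply/memv_imgP; exists (mkprodv (fun x => (phi x \o hom_at iota x)%VF)).
  exact: memvf.
rewrite !lfunE; apply/prodvP=> a; rewrite !mkprodvE.
by rewrite comp_lfunDl comp_lfunNl -!comp_lfunA iotaP.
Qed.

(* The map [Ext(V, W) -> Ext(S, W)] induced by [iota : S -> V]. *)
Definition ext_map (e : ExtQ V W) : ExtQ S W :=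
  coker_pi (d_map S W) (precomp (coker_repr e)).

Lemma ext_map_pi X :
  ext_map (coker_pi (d_map V W) X) = coker_pi (d_map S W) (precomp X).
Proof.
apply/coker_piP; rewrite -linearB precomp_limg //.
exact/coker_piP/coker_piK.
Qed.

Fact ext_map_linear : linear ext_map.
Proof.
move=> c d e; rewrite -[d]coker_piK -[e]coker_piK.
by rewrite -linearP !ext_map_pi !linearP.
Qed.
HB.instance Definition _ :=
  GRing.isLinear.Build K (ExtQ V W) (ExtQ S W) _ ext_map ext_map_linear.

End ExtMap.

Section Kernel.
Variables (E F : vertex Q -> vectType K) (V : repn E) (W : repn F).
Variable phi : homQ V W.

Definition ker_space (x : vertex Q) : vectType K :=
  subvs_of (lker (hom_at phi x)).

Definition ker_repn : repn ker_space :=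
  mkprodv (fun a => (linfun (vsproj (lker (hom_at phi (head a))))
                     \o V a \o linfun vsval)%VF).

Definition ker_incl_fun : hom0 ker_space E := mkprodv (fun x => linfun vsval).

Fact ker_incl_subproof : ker_incl_fun \in HomQ ker_repn V.
Proof.
apply/HomQP=> a; rewrite !mkprodvE; apply/lfunP=> u.
rewrite !(comp_lfunE, lfunE) /= vsprojK //.
have /HomQP/(_ a)/lfunP/(_ (vsval u)) := valP phi.
rewrite !comp_lfunE memv_ker => <-.
by have := valP u; rewrite memv_ker => /eqP ->; rewrite linear0.
Qed.

Definition ker_incl : homQ ker_repn V := Subvs ker_incl_subproof.

End Kernel.

Lemma dim_ker_space (alpha beta gamma : vertex Q -> nat) (V : Rep alpha)
    (W : Rep beta) (phi : homQ V W) x :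
  has_rank phi gamma -> \dim {: ker_space phi x} = (alpha x - gamma x)%N.
Proof.
move=> /(_ x) <-; have := limg_ker_dim (hom_at phi x) fullv.
by rewrite capfv !dimvf /dim /= muln1 => <-; rewrite addnK.
Qed.

End Representations.

Arguments ext_map {K Q E F G S V} W iota e.

(* Main.v *)
Require Import Defs.
From mathcomp Require Import all_boot all_order all_algebra.
From mathcomp Require Import classical_sets boolp reals mpoly complex.

(** Let [phi : V -> W] have kernel [S]. A class of [Ext(V, W)] that vanishes in
    [Ext(S, W)] is represented by [A \o phi] for some direction [A] in
    [Rep(Q, beta)]. Along the line [W + t A], the differential
    [d(W + t A) = d(W) + t (A \o _)] has generically constant rank, because
    [dim Hom(V, _)] is constant on the open set [U], so [A \o _] maps
    [Hom(V, W) = ker d(W)] into the image of [d(W)], and the class is zero. *)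

Set Implicit Arguments.
Unset Strict Implicit.
Unset Printing Implicit Defensive.

Import GRing.Theory.

Local Open Scope ring_scope.

Lemma horner_mmap_line (K : comNzRingType) n (p : {mpoly K[n]})
    (a b : 'I_n -> K) (t : K) :
  (mmap polyC (fun i => (a i)%:P + (b i)%:P * 'X) p).[t]
    = p.@[fun i => a i + b i * t].
Proof.
rewrite /meval /mmap horner_sum; apply: eq_bigr => m _.
rewrite hornerM hornerC /mmap1 horner_prod; congr (_ * _).
by apply: eq_bigr => i _; rewrite horner_exp !hornerE.
Qed.

(** Some equation of the complement of [U] fails at [v]. Restricted to the line it becomes a
    polynomial in [t] whose value at [0] is nonzero. *)
Lemma zariski_open_line (K : fieldType) (E : vectType K) (U : set E)
    (v w : E) :
  zariski_open U -> U v ->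
  exists2 p : {poly K}, p != 0 & forall t, p.[t] != 0 -> U (v + t *: w).
Proof.
move=> [F UF] Uv.
have [p [Fp pv]] : exists p, F p /\
    p.@[fun i => coord (vbasis {:E}) i v] != 0.
  apply: contrapT => nF; have := UF v; case=> _; apply=> // p Fp.
  by apply/eqP/negPn/negP=> pv; apply: nF; exists p.
pose a i := coord (vbasis {:E}) i v; pose b i := coord (vbasis {:E}) i w.
pose q := mmap polyC (fun i => (a i)%:P + (b i)%:P * 'X) p.
have qE t : q.[t] = p.@[fun i => coord (vbasis {:E}) i (v + t *: w)].
  rewrite /q horner_mmap_line; apply: meval_eq => i.
  by rewrite linearD linearZ /= /a /b [t * _]mulrC.
exists q => [|t].
  apply: contraNneq pv => q0; have := qE 0.
  by rewrite scale0r addr0 q0 horner0 => <-.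
rewrite qE => qt; apply: contrapT => nU; case/negP: qt.
by have [/(_ nU)/(_ p Fp) -> _] := UF (v + t *: w).
Qed.

Lemma det_1D_poly (K : comNzRingType) n (N : 'M[K]_n) (t : K) :
  (\det (1%:M + 'X *: map_mx polyC N)).[t] = \det (1%:M + t *: N).
Proof.
rewrite -[LHS]/(horner_eval t _) -det_map_mx; congr (\det _).
apply/matrixP=> i j.
by rewrite !mxE /= /horner_eval hornerD hornerM hornerX hornerMn !hornerC.
Qed.

(** The functionals [coord z j] send the perturbed family to the matrix [1 + t N], whose determinant
    is a polynomial in [t] equal to [1] at [t = 0]. *)
Lemma free_perturb (K : fieldType) (E : vectType K) n (z w : n.-tuple E) :
  free z ->
  exists2 p : {poly K}, p != 0 &
    forall t, p.[t] != 0 -> free [tuple z`_i + t *: w`_i | i < n].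
Proof.
move=> z_free; pose N := \matrix_(i, j) coord z j w`_i : 'M[K]_n.
exists (\det (1%:M + 'X *: map_mx polyC N)) => [|t].
  apply/eqP=> p0; have := det_1D_poly N 0.
  by rewrite p0 horner0 scale0r addr0 det1 => /esym/eqP; rewrite oner_eq0.
rewrite det_1D_poly => det_neq0; apply/freeP=> k k0.
suff /rowP r0 : \row_j k j = 0 by move=> i; have := r0 i; rewrite !mxE.
have Nu : 1%:M + t *: N \in unitmx by rewrite unitmxE unitfE.
apply: (can_inj (mulmxK Nu)); rewrite mul0mx; apply/rowP=> j.
have := congr1 (coord z j) k0; rewrite linear_sum linear0 !mxE => kj; rewrite -[RHS]kj.
apply: eq_bigr => i _.
rewrite linearZ /= nth_mktuple.
by rewrite linearD linearZ /= coord_free // !mxE.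
Qed.

(* Lifting a basis of [limg f] and adding [g u] gives [\dim (limg f) + 1]
   vectors that are free at [t = 0], hence for generic [t]. *)
Lemma rank_perturb (K : fieldType) (aT rT : vectType K) (f g : 'Hom(aT, rT))
    (u : aT) :
  u \in lker f -> g u \notin limg f ->
  exists2 p : {poly K}, p != 0 &
    forall t, p.[t] != 0 -> (\dim (limg f) < \dim (limg (f + t *: g)%R))%N.
Proof.
rewrite memv_ker => /eqP fu gu.
pose e i : aT := (f^-1)%VF (vbasis (limg f))`_i.
have fe i : (i < \dim (limg f))%N -> f (e i) = (vbasis (limg f))`_i.
  move=> lti; rewrite limg_lfunVK //; apply: vbasis_mem.
  by rewrite mem_nth // size_tuple.
pose z := [tuple of g u :: vbasis (limg f)].
pose w := [tuple of 0 :: [tuple g (e i) | i < \dim (limg f)]].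
have z_free : free z.
  rewrite free_cons (basis_free (vbasisP _)) andbT.
  by rewrite (span_basis (vbasisP _)).
have [p p0 pP] := free_perturb w z_free.
(* The factor ['X] excludes [t = 0], because [g u] is reached as the image of [t^-1 *: u]. *)
exists (p * 'X) => [|t]; first by rewrite mulf_neq0 ?polyX_eq0.
rewrite hornerM hornerX mulf_eq0 negb_or => /andP[/pP zt_free t0].
have := eqnP zt_free; rewrite size_tuple => <-; apply/dimvS/span_subvP.
move=> _ /mapP[i _ ->]; case: (unliftP ord0 i) => [j|] -> /=.
  rewrite add0n nth_mktuple -(fe j) //.
  have -> : f (e j) + t *: g (e j) = (f + t *: g) (e j).
    by rewrite add_lfunE scale_lfunE.
  exact: memv_img (memvf _).
rewrite scaler0 addr0.
have -> : g u = (f + t *: g) (t^-1 *: u).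
  by rewrite linearZ /= add_lfunE scale_lfunE fu add0r scalerK.
exact: memv_img (memvf _).
Qed.

(** [f^-1] is a section of [f] over its image, so [f^-1 (f u)] differs from [u] by an element of
    [lker f], which [g] kills. *)
Lemma factor_through (K : fieldType) (aT bT cT : vectType K) (f : 'Hom(aT, bT))
    (g : 'Hom(aT, cT)) :
  (lker f <= lker g)%VS -> (g \o f^-1 \o f)%VF = g.
Proof.
move=> /subvP ker_sub; apply/lfunP=> u; rewrite !comp_lfunE; apply/eqP.
rewrite -subr_eq0 -linearB -memv_ker; apply: ker_sub.
by rewrite memv_ker linearB /= limg_lfunVK ?subrr // memv_img ?memvf.
Qed.

Lemma prodv0 (K : fieldType) (I : finType) (E : I -> vectType K) i :
  (0 : prodv E) i = 0.
Proof. exact: mkprodvE. Qed.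

Lemma d_mapE (K : fieldType) (Q : quiver) (E F : vertex Q -> vectType K)
    (V : repn E) (W : repn F) (phi : hom0 E F) a :
  d_map V W phi a = ((W a \o phi (tail a)) - (phi (Defs.head a) \o V a))%VF.
Proof. by rewrite lfunE mkprodvE. Qed.

Section QuiverRepresentations.
Variables (K : fieldType) (Q : quiver).
Variables (E F : vertex Q -> vectType K) (V : repn E).

(** The term of the differential involving [V] does not depend on [W]. With [0] in place of [V] that
    term vanishes, so [d_map 0 A] is composition with [A]. *)
Lemma d_map_line (W A : repn F) t :
  d_map V (W + t *: A) = d_map V W + t *: d_map 0 A.
Proof.
apply/lfunP=> phi; rewrite add_lfunE scale_lfunE; apply/prodvP=> a.
rewrite prodvD prodvZ !d_mapE prodvD prodvZ.
rewrite prodv0; apply/lfunP=> u.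
rewrite !(add_lfunE, opp_lfunE, scale_lfunE, comp_lfunE) zero_lfunE linear0.
by rewrite subr0 addrAC.
Qed.

Lemma dim_limg_d_map (W W' : repn F) :
  \dim (HomQ V W) = \dim (HomQ V W') ->
  \dim (limg (d_map V W)) = \dim (limg (d_map V W')).
Proof.
move=> eq_ker; apply/eqP; rewrite -(eqn_add2l (\dim (HomQ V W))).
rewrite {2}eq_ker.
have := limg_ker_dim (d_map V W) fullv.
by rewrite -(limg_ker_dim (d_map V W') fullv) !capfv => ->.
Qed.

Variables (W : repn F) (phi : homQ V W).

Lemma precomp_in_limg (A : repn F) (P : repn F -> Prop) :
  (exists2 p : {poly K}, p != 0 & forall t, p.[t] != 0 -> P (W + t *: A)) ->
  (forall W', P W' -> \dim (HomQ V W') = \dim (HomQ V W)) ->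
  (forall p : {poly K}, p != 0 -> exists t, p.[t] != 0) ->
  precomp phi A \in limg (d_map V W).
Proof.
move=> [p p0 pP] dimP nonroot.
have -> : precomp phi A = d_map 0 A (vsval phi).
  apply/prodvP=> a; rewrite d_mapE prodv0 mkprodvE; apply/lfunP=> u.
  by rewrite !(add_lfunE, opp_lfunE, comp_lfunE) zero_lfunE linear0 subr0.
apply: contraT => /(rank_perturb (valP phi)) [q q0 qP].
(* A nonroot of the product gives one [t] at which [W + t *: A] satisfies [P] and the rank has
   jumped, a contradiction. *)
have [t] := nonroot _ (mulf_neq0 p0 q0).
rewrite hornerM mulf_eq0 negb_or => /andP[/pP/dimP/dim_limg_d_map dimE /qP].
by rewrite -d_map_line dimE ltnn.
Qed.

Lemma ker_inclE x (u : ker_space phi x) : hom_at (ker_incl phi) x u = vsval u.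
Proof. by rewrite /hom_at /= mkprodvE lfunE. Qed.

Lemma ext_map_ker_inj :
  (forall A : repn F, precomp phi A \in limg (d_map V W)) ->
  injective (ext_map W (ker_incl phi)).
Proof.
move=> phi_limg; apply: raddf_inj => e /=.
rewrite -[e]coker_piK ext_map_pi; move: (coker_repr e) => X.
rewrite -[0](linear0 (coker_pi (d_map _ W))) => /coker_piP.
rewrite subr0 => /memv_imgP[psi _ Xpsi].
(* Extend [psi] from the kernel to all of [V] by a linear retraction at each vertex. Subtracting the
   coboundary of [psi'] from [X] then makes it vanish on the kernel. *)
pose psi' : hom0 E F :=
  mkprodv (fun x => (psi x \o linfun (vsproj (lker (hom_at phi x))))%VF).
pose Y : hom1 E F := X - d_map V W psi'.
pose A : repn F := mkprodv (fun a => (Y a \o (hom_at phi (tail a))^-1)%VF).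
have YA : Y = precomp phi A.
  apply/prodvP=> a; rewrite !mkprodvE factor_through //.
  apply/subvP=> u u_ker; rewrite memv_ker; apply/eqP.
  have /lfunP/(_ (Subvs u_ker)) := congr1 (fun Z : hom1 _ _ => Z a) Xpsi.
  rewrite !d_mapE !mkprodvE !(add_lfunE, opp_lfunE, comp_lfunE).
  rewrite ker_inclE !lfunE /= => ->.
  apply/eqP; rewrite subr_eq0; apply/eqP; congr (W a (psi _ _) - _).
  by apply: val_inj; rewrite /= vsprojK.
rewrite -[0](linear0 (coker_pi (d_map V W))); apply/coker_piP; rewrite subr0.
by rewrite -(subrK (d_map V W psi') X) -/Y YA memvD ?phi_limg ?memv_img ?memvf.
Qed.

(** This gives surjectivity: every family of maps out of the kernel extends to [V] through linear
    retractions at the tails. *)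
Definition ext_ker_section (e : ExtQ (ker_repn phi) W) : ExtQ V W :=
  coker_pi (d_map V W) (mkprodv (fun a =>
    (coker_repr e a \o linfun (vsproj (lker (hom_at phi (tail a)))))%VF)).

Lemma ext_ker_sectionK : cancel ext_ker_section (ext_map W (ker_incl phi)).
Proof.
move=> e; rewrite ext_map_pi -[RHS]coker_piK; congr coker_pi.
apply/prodvP=> a; rewrite !mkprodvE; apply/lfunP=> u.
by rewrite !comp_lfunE ker_inclE lfunE /= vsvalK.
Qed.

End QuiverRepresentations.

Theorem proposition4p1 (R : realType) (Q : quiver)
    (Q_acyclic : no_oriented_cycle Q)
    (alpha beta : vertex Q -> nat) (V : Rep R[i] alpha)
    (U : set (Rep R[i] beta)) (U_open : zariski_open U)
    (U_dense : zariski_dense U)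
    (dim_const : forall W W' : Rep R[i] beta, U W -> U W' ->
       \dim (HomQ V W) = \dim (HomQ V W'))
    (gamma : vertex Q -> nat)
    (rank_generic : forall W : Rep R[i] beta, U W ->
       exists D : set (homQ V W),
         [/\ zariski_open D, zariski_dense D &
             forall phi, D phi -> has_rank phi gamma])
    (W : Rep R[i] beta) (U_W : U W)
    (phi : homQ V W) (phi_rank : has_rank phi gamma) :
  bijective (ext_map W (ker_incl phi)).
Proof.
have inj : injective (ext_map W (ker_incl phi)).
  apply: ext_map_ker_inj => A; apply: (@precomp_in_limg _ _ _ _ _ _ _ A U).
  - exact: zariski_open_line.
  - by move=> W' UW'; apply: dim_const.
  (* [R[i]] is algebraically closed, hence infinite, so a nonzero polynomial has a nonroot. *)
  - by move=> p /closed_nonrootP.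
by exists (@ext_ker_section _ _ _ _ V W phi);
  [apply: inj_can_sym inj|]; apply: ext_ker_sectionK.
Qed.
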